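(* Let $D$ be a digraph on $\{1,\dots,N\}$ (as in the context), and suppose $(i_1,j_1),(i_2,j_2),\ldots,(i_n,j_n)$ are prime pairs of $D$ such that $j_k\le i_{k+1}$ for $1\le k\le n-1$, and such that for every $1\le k\le n$ there is an edge $e_k$ from $i_k$ to $j_k$ in $D$. Let $D'$ be the graph obtained from $D$ by deleting $e_k$ for $1\le k\le n$. If $D'$ is bipartite, then $D$ is invertible.
   Context: Digraphs $D$ are finite, with vertex set $\{1,\dots,N\}$, may have multiple edges but no loops, and every directed edge $i\to j$ satisfies $i<j$. Let $B=B_D$ be the $N\times N$ upper unitriangular integer matrix with $B_{i,i}=1$ and $B_{i,j}$ equal to the number of edges from $i$ to $j$ for $i\ne j$. $D$ is invertible if there is a diagonal matrix $S$ with diagonal entries in $\{\pm1\}$ such that $SB^{-1}S=|B^{-1}|$, where $|\cdot|$ is the componentwise absolute value. ''Path'' always means directed path. A digraph is called bipartite if its underlying undirected graph is. An ordered pair $(i,j)$ of distinct vertices is a prime pair of $D$ if: there is a path from $i$ to $j$ in $D$; not all paths from $i$ to $j$ have length $1$; and there is no vertex $k$ with $i<k<j$ such that every path from $i$ to $j$ passes through $k$. *)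

(* Defs.v *)
From HB Require Import structures.
From mathcomp Require Import all_boot all_order all_algebra.

Set Implicit Arguments.
Unset Strict Implicit.
Unset Printing Implicit Defensive.

Import Order.TTheory GRing.Theory Num.Theory.
Local Open Scope ring_scope.

(* The vertex set {1, ..., N} is represented by 'I_N, so vertex v of the
   mathematical text is the ordinal v - 1; only the order of the vertices is
   ever used.  Edges form a finite type of their own, so that parallel edges
   are distinct and one of them can be deleted without the others. *)
Record digraph (N : nat) := Digraph {
  edge : finType;
  src : edge -> 'I_N;
  tgt : edge -> 'I_N;
  src_lt_tgt : forall e : edge, (src e < tgt e)%N
}.

Definition edge_mx (N : nat) (D : digraph N) : 'M[int]_N :=
  \matrix_(i, j) (if i == j then 1
                  else (#|[set e : edge D | (src e == i) && (tgt e == j)]|)%:Z).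

(* [invmx] is a genuine inverse only on [unitmx]; over int this membership
   means invertibility by an integer matrix. *)
Lemma edge_mx_unit (N : nat) (D : digraph N) : edge_mx D \in unitmx.
Proof.
rewrite unitmxE -det_tr det_trig; last first.
  apply/is_trig_mxP => i j lt_ij; rewrite !mxE.
  case: eqP => [eq_ji|_]; first by rewrite eq_ji ltnn in lt_ij.
  rewrite (_ : [set e | _] = set0) ?cards0 //.
  apply/setP => e; rewrite !inE; apply/negbTE/negP => /andP[/eqP se /eqP te].
  by have := src_lt_tgt e; rewrite se te ltnNge (ltnW lt_ij).
by rewrite big1 ?unitr1 // => i _; rewrite !mxE eqxx.
Qed.

Definition invertible (N : nat) (D : digraph N) : Prop :=
  exists S : 'M[int]_N,
    [/\ is_diag_mx S,
        forall i, S i i = 1 \/ S i i = -1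
      & S *m invmx (edge_mx D) *m S = map_mx Num.norm (invmx (edge_mx D))].

(* A path is the list of its edges; its length is the size of that list. *)
Fixpoint is_path (N : nat) (D : digraph N) (i : 'I_N) (p : seq (edge D))
    (j : 'I_N) : bool :=
  if p is e :: p' then (src e == i) && is_path (tgt e) p' j else i == j.

Definition path_vertices (N : nat) (D : digraph N) (i : 'I_N)
    (p : seq (edge D)) : seq 'I_N :=
  i :: [seq tgt e | e <- p].

Definition prime_pair (N : nat) (D : digraph N) (i j : 'I_N) : Prop :=
  [/\ i <> j,
      exists p : seq (edge D), is_path i p j,
      ~ (forall p : seq (edge D), is_path i p j -> size p = 1%N)
    & ~ (exists k : 'I_N, (i < k < j)%N /\
           forall p : seq (edge D), is_path i p j -> k \in path_vertices i p)].

Definition delete_edges (N : nat) (D : digraph N) (F : {set edge D})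
  : digraph N :=
  @Digraph N {e : edge D | e \notin F}
    (fun e => src (val e)) (fun e => tgt (val e))
    (fun e => src_lt_tgt (val e)).

Definition undirected_adj (N : nat) (D : digraph N) : rel 'I_N :=
  fun i j => [exists e : edge D, ((src e == i) && (tgt e == j))
                              || ((src e == j) && (tgt e == i))].

Definition bipartite (N : nat) (D : digraph N) : Prop :=
  exists A : {set 'I_N},
    forall i j : 'I_N, undirected_adj D i j -> (i \in A) != (j \in A).

(* Main.v *)
Require Import Defs.
From HB Require Import structures.
From mathcomp Require Import all_boot all_order all_algebra zify.

Set Implicit Arguments.
Unset Strict Implicit.
Unset Printing Implicit Defensive.

Import Order.TTheory GRing.Theory Num.Theory.
Local Open Scope ring_scope.

(** Let [s] be the sign function of a two-colouring of [D'].  Conjugating the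
    inverse [X] of [edge_mx D] by the diagonal matrix of [s] gives
    [f u v = s u * X u v * s v], and [X *m edge_mx D = 1] turns into
    [f u v = (u == v) + \sum_(t into v) eps t * f u (src t)] with
    [eps t = - s (src t) * s (tgt t)]; this is [edge_mx_inv_rec].  Every edge
    of [D'] has [eps t = 1], so only the edges [e k] may carry a minus sign.
    It suffices that [f u v >= 0] for all [u] and [v], since then
    [f u v = `|X u v|].

    Going up along the vertices, the only danger is at [v = j k], where [e k]
    may contribute [- f u (i k)].  Primality of [(i k, j k)] supplies a detour,
    a path of length at least 2 from [i k] to [j k].  No negative edge ends
    strictly between [i k] and [j k], the intervals being disjoint; hence [f u]
    does not decrease along the detour up to the source [w] of its last edge,
    and the contribution [f u w] of that edge pays for [- f u (i k)].  This is
    [signed_superharmonic_ge0]. *)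

Lemma is_path_leq (N : nat) (D : digraph N) (p : seq (edge D)) (a b : 'I_N) :
  is_path a p b -> (a <= b)%N.
Proof.
elim: p a => [|t p IHp] a /=; first by move/eqP->.
by case/andP=> /eqP<- /IHp; apply/leq_trans/ltnW/src_lt_tgt.
Qed.

Lemma is_path_rcons (N : nat) (D : digraph N) (p : seq (edge D)) t
    (a b : 'I_N) :
  is_path a (rcons p t) b = is_path a p (src t) && (tgt t == b).
Proof.
elim: p a => [|t' p IHp] a /=; first by rewrite eq_sym.
by rewrite IHp andbA.
Qed.

(** An inequality, because the rows of the conjugated inverse satisfy the signed
    recurrence up to the nonnegative source term [(u == v)]. *)
Definition superharmonic (N : nat) (D : digraph N) (neg : {set edge D})
    (f : 'I_N -> int) :=
  forall v, \sum_(t | tgt t == v) (-1) ^+ (t \in neg) * f (src t) <= f v.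

(** When all edges into [tgt t] are positive, each of them contributes a
    nonnegative term to the lower bound for [f (tgt t)], and the term of [t] is
    [f (src t)]. *)
Lemma superharmonic_edge_le (N : nat) (D : digraph N) (neg : {set edge D})
    (f : 'I_N -> int) (t : edge D) :
    superharmonic neg f ->
    (forall w : 'I_N, (w < tgt t)%N -> 0 <= f w) ->
    (forall t', tgt t' = tgt t -> t' \notin neg) ->
  f (src t) <= f (tgt t).
Proof.
move=> f_super f_ge0 pos; apply: le_trans (f_super _).
rewrite (bigD1 t) //= (negbTE (pos t _)) // mul1r lerDl.
apply: sumr_ge0 => t' /andP[/eqP tt' _].
by rewrite (negbTE (pos _ tt')) mul1r f_ge0 // -tt' src_lt_tgt.
Qed.

Lemma superharmonic_path_le (N : nat) (D : digraph N) (neg : {set edge D})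
    (f : 'I_N -> int) (p : seq (edge D)) (a b : 'I_N) :
    superharmonic neg f -> is_path a p b ->
    (forall w : 'I_N, (w < b)%N -> 0 <= f w) ->
    (forall t, (a < tgt t <= b)%N -> t \notin neg) ->
  f a <= f b.
Proof.
move=> f_super; elim: p a => [|t p IHp] a /=; first by move/eqP->.
case/andP=> /eqP<- path_p f_ge0 pos.
have le_tb := is_path_leq path_p.
apply: (@le_trans _ _ (f (tgt t))).
  apply: (superharmonic_edge_le f_super) => [w lt_w | t' tt'].
    exact/f_ge0/(leq_trans lt_w).
  by apply: pos; rewrite tt' src_lt_tgt.
apply: IHp => // t' /andP[lt_t' le_t'].
by apply: pos; rewrite le_t' (ltn_trans (src_lt_tgt t)).
Qed.

(** The last edge of a detour around a negative edge [t] is positive, and [f]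
    at its source is at least [f (src t)] by monotonicity along the detour, so
    the two contributions to [f (tgt t)] add up to something nonnegative. *)
Lemma signed_superharmonic_ge0 (N : nat) (D : digraph N) (neg : {set edge D})
    (f : 'I_N -> int) :
    superharmonic neg f ->
    {in neg &, forall t t', t != t' ->
       (tgt t <= src t')%N || (tgt t' <= src t)%N} ->
    {in neg, forall t,
       ~ forall p : seq (edge D), is_path (src t) p (tgt t) -> size p = 1%N} ->
  forall v, 0 <= f v.
Proof.
move=> f_super sep detour v; have [m] := ubnP (v : nat).
elim: m v => // m IHm v; rewrite ltnS => le_vm.
have f_ge0 (w : 'I_N) : (w < v)%N -> 0 <= f w.
  by move=> lt_wv; apply/IHm/(leq_trans lt_wv).
apply: le_trans (f_super v).
have [/existsP[t /andP[neg_t /eqP tv]] | no_neg] :=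
    boolP [exists t, (t \in neg) && (tgt t == v)]; last first.
  apply: sumr_ge0 => t /eqP tv; case: (boolP (t \in neg)) => [neg_t|_] /=.
    by case/existsP: no_neg; exists t; rewrite neg_t tv eqxx.
  by rewrite mul1r f_ge0 // -tv src_lt_tgt.
(* By separation no negative edge but [t] ends in the interval of [t]. *)
have only_neg t' : t' \in neg -> (src t < tgt t' <= tgt t)%N -> t' = t.
  move=> neg_t' /andP[lt_t' le_t']; apply/eqP/contraT => /(sep _ _ neg_t' neg_t).
  case/orP=> le; first by rewrite leqNgt lt_t' in le.
  by have:= leq_trans (src_lt_tgt t') (leq_trans le_t' le); rewrite ltnn.
(* The conclusion is boolean, so it may be proved by contradiction, which
   extracts the detour [p] constructively. *)
apply: contraT => f_lt0; case: (detour t neg_t) => p path_p.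
apply/eqP; apply: contraT => size_p; case/negP: f_lt0.
case/lastP: p path_p size_p => [/eqP eq_t _ | p t'].
  by have:= src_lt_tgt t; rewrite eq_t ltnn.
rewrite is_path_rcons => /andP[path_p /eqP tt'].
rewrite size_rcons eqSS size_eq0 => p_neq0.
have lt_src : (src t < src t')%N.
  case: p path_p p_neq0 => //= t1 p /andP[/eqP<- path_p] _.
  exact: leq_trans (src_lt_tgt t1) (is_path_leq path_p).
have lt_src_v : (src t' < v)%N by rewrite -tv -tt' src_lt_tgt.
have t'_neq : t' != t by apply: contraTneq lt_src => ->; rewrite ltnn.
have pos_t' : t' \notin neg.
  apply: contra t'_neq => /only_neg ->//.
  by rewrite tt' leqnn src_lt_tgt.
have le_f : f (src t) <= f (src t').
  apply: (superharmonic_path_le f_super path_p) => [w lt_w|t1 /andP[lt_t1 le_t1]].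
    exact/f_ge0/(ltn_trans lt_w).
  have lt_t1v : (tgt t1 < tgt t)%N by rewrite tv (leq_ltn_trans le_t1).
  apply/negP => /only_neg t1E; move: (lt_t1v).
  by rewrite t1E ?ltnn // lt_t1 ltnW.
rewrite (bigD1 t) ?tv //= (bigD1 t') ?tt' ?tv ?eqxx ?t'_neq //=.
rewrite neg_t (negbTE pos_t') mulN1r mul1r addrA addr_ge0 //.
  by rewrite addrC subr_ge0.
apply: sumr_ge0 => t1 /andP[/andP[/eqP t1v t1_neq] _].
have/negbTE-> : t1 \notin neg.
  apply: contra t1_neq => /only_neg ->//.
  by rewrite t1v tv leqnn -tv src_lt_tgt.
by rewrite mul1r f_ge0 // -t1v src_lt_tgt.
Qed.

(** The equation [X *m edge_mx D = 1] read entrywise.  Summing over the edges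
    into [v] rather than over its predecessors absorbs the multiplicities, and
    conjugation by signs then just attaches a sign to each edge. *)
Lemma edge_mx_inv_rec (N : nat) (D : digraph N) (u v : 'I_N) :
  let X := invmx (edge_mx D) in
  X u v + \sum_(t : edge D | tgt t == v) X u (src t) = (u == v)%:R.
Proof.
move=> X; have := mulVmx (edge_mx_unit D); rewrite -/X.
move/matrixP/(_ u v); rewrite !mxE => <-.
rewrite (bigD1 v) //= mxE eqxx mulr1; congr (_ + _).
rewrite (partition_big (@src N D) (fun w => w != v)) /= => [|t /eqP<-]; last first.
  by rewrite -val_eqE ltn_eqF ?src_lt_tgt.
apply: eq_bigr => w /negbTE w_neq; rewrite mxE w_neq.
rewrite (eq_bigr (fun=> X u w)) => [|t /andP[_ /eqP->] //].
rewrite sumr_const -[_ *+ _]mulr_natr natz; congr (_ * _%:Z).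
by apply: eq_card => t; rewrite !inE andbC.
Qed.

Theorem theorem3p24 (N : nat) (D : digraph N) (n : nat)
    (i j : 'I_n -> 'I_N) (e : 'I_n -> edge D)
    (Hprime : forall k : 'I_n, prime_pair D (i k) (j k))
    (Hchain : forall k l : 'I_n, l = k.+1 :> nat -> (j k <= i l)%N)
    (Hedge : forall k : 'I_n, src (e k) = i k /\ tgt (e k) = j k)
    (Hbip : bipartite (delete_edges [set e k | k : 'I_n])) :
  invertible D.
Proof.
have [A bipA] := Hbip; set X := invmx (edge_mx D).
(* The edges joining vertices of the same colour, i.e. those with [eps = -1]. *)
pose neg : {set edge D} := [set t | (src t \in A) == (tgt t \in A)].
have neg_e t : t \in neg -> exists k, t = e k.
  move=> neg_t; have [/imsetP[k _ ->]|pos_t] := boolP (t \in [set e k | k : 'I_n]).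
    by exists k.
  have /bipA : undirected_adj (delete_edges [set e k | k : 'I_n]) (src t) (tgt t).
    by apply/existsP; exists (exist _ t pos_t); rewrite /= !eqxx.
  by move: neg_t; rewrite inE => ->.
have chain (k l : 'I_n) : (k < l)%N -> (j k <= i l)%N.
  case: l => m; elim: m => // m IHm lt_m /=; rewrite ltnS leq_eqVlt.
  case/predU1P => [km|lt_km]; first by apply: Hchain; rewrite /= km.
  apply: leq_trans (IHm (ltnW lt_m) lt_km) _.
  apply: (@leq_trans (j (Ordinal (ltnW lt_m)))); last exact: Hchain.
  by have [<- <-] := Hedge (Ordinal (ltnW lt_m)); apply/ltnW/src_lt_tgt.
pose s (v : 'I_N) : int := (-1) ^+ (v \in A).
have ss v : s v * s v = 1 by rewrite -expr2 sqrr_sign.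
have sXs_ge0 u v : 0 <= s u * X u v * s v.
  apply: (@signed_superharmonic_ge0 N D neg (fun v => s u * X u v * s v)).
  - move=> {}v; have suv_ge0 : 0 <= s u * (u == v)%:R * s v.
      by case: eqP => [->|_]; rewrite ?mulr1 ?ss // mulr0 mul0r.
    rewrite -subr_ge0; apply: le_trans suv_ge0 _.
    rewrite -(edge_mx_inv_rec D u v) -/X mulrDr mulrDl lerD2l.
    rewrite mulr_sumr mulr_suml -sumrN ler_sum // => t /eqP <-.
    rewrite inE /s; move: (X _ _) => x.
    by case: (u \in A); case: (src t \in A); case: (tgt t \in A) => /=; lia.
  - move=> t t' /neg_e[k ->] /neg_e[l ->] neq.
    have [[-> ->] [-> ->]] := (Hedge k, Hedge l).
    have [/chain->//|/chain->|/val_inj kl] := ltngtP k l; first by rewrite orbT.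
    by rewrite kl eqxx in neq.
  - move=> t /neg_e[k ->]; have [-> ->] := Hedge k.
    by have [_ _ long _] := Hprime k.
exists (diag_mx (\row_v s v)); split=> [|v|].
- exact: diag_mx_is_diag.
- by rewrite !mxE eqxx mulr1n /s; case: (v \in A); [right | left].
apply/matrixP => u v; rewrite mul_diag_mx mul_mx_diag !mxE.
by rewrite -[LHS]ger0_norm ?sXs_ge0 // !normrM !normr_sign mul1r mulr1.
Qed.
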